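(* Let $A_d=K[X_d]_+$ be the algebra of polynomials without constant term and let $G$ be a subgroup of $GL_d(K)$. If $(A_d^2)^G$ is not finitely generated as a $K[(A_d)_1^G]$-module, then the algebra $F_d({\mathfrak V})^G$ is not finitely generated (as a $K$-algebra) for any variety $\mathfrak V$ containing $\mathfrak L$.
   Context: $K$ is a field of characteristic $0$, $d\ge 2$ is an integer, and algebras are $K$-algebras, not necessarily associative or unital. A variety is the class of all algebras satisfying a given set of polynomial identities (elements of the absolutely free nonassociative algebra $K\{x_1,x_2,\ldots\}$). For a variety $\mathfrak V$, $F_d(\mathfrak V)$ is the relatively free algebra of $\mathfrak V$ of rank $d$, freely generated by $X_d=\{x_1,\ldots,x_d\}$, i.e. $K\{x_1,\ldots,x_d\}$ (without constant terms) modulo the polynomial identities of $\mathfrak V$ in $x_1,\ldots,x_d$. $\mathfrak L$ is the variety of algebras defined by the right-symmetric identity $(x_1,x_2,x_3)=(x_1,x_3,x_2)$, where $(x_1,x_2,x_3)=x_1(x_2x_3)-(x_1x_2)x_3$, together with $x_1(x_2x_3)=0$. $GL_d(K)$ acts canonically on the vector space $KX_d$ with basis $X_d$, and this action is extended to $F_d(\mathfrak V)$ and to $K[X_d]=K[x_1,\ldots,x_d]$ by $g(f(x_1,\ldots,x_d))=f(g(x_1),\ldots,g(x_d))$. The superscript $G$ denotes the set of elements fixed by all $g\in G$. $A_d^2$ is the square of the ideal $A_d$ of $K[X_d]$, i.e. the polynomials without constant and linear terms. $(A_d)_1=KX_d$ is the space of linear forms, $(A_d)_1^G=(KX_d)^G$,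 and $K[(A_d)_1^G]$ is the unital subalgebra of $K[X_d]$ generated by $(A_d)_1^G$; it acts on $(A_d^2)^G$ by multiplication. *)

(* Defs.v *)
From HB Require Import structures.
From mathcomp Require Import all_boot all_order all_algebra.
From mathcomp Require Import generic_quotient ring_quotient finmap.
From mathcomp Require Import boolp.
From mathcomp Require monalg.
From mathcomp Require mpoly.

Set Implicit Arguments.
Unset Strict Implicit.
Unset Printing Implicit Defensive.

Import GRing.Theory.
Local Open Scope ring_scope.
Local Open Scope quotient_scope.

HB.mixin Record Lmodule_isNonassocAlgebra (K : nzRingType) A
    of GRing.Lmodule K A := {
  namul : A -> A -> A;
  namulDl : forall x y z, namul (x + y) z = namul x z + namul y z;
  namulDr : forall x y z, namul x (y + z) = namul x y + namul x z;
  namulZl : forall c x y, namul (c *: x) y = c *: namul x y;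
  namulZr : forall c x y, namul x (c *: y) = c *: namul x y
}.

#[short(type="nonassocAlgType")]
HB.structure Definition NonassocAlgebra (K : nzRingType) :=
  {A of GRing.Lmodule K A & Lmodule_isNonassocAlgebra K A}.

Notation "x ** y" := (namul x y) (at level 40, left associativity) : ring_scope.

Section NonassocTheory.
Variables (K : nzRingType) (A : nonassocAlgType K).
Implicit Types x y z : A.

Lemma namul0l x : 0 ** x = 0.
Proof. by rewrite -[in LHS](scale0r x) namulZl scale0r. Qed.

Lemma namul0r x : x ** 0 = 0.
Proof. by rewrite -[in LHS](scale0r x) namulZr scale0r. Qed.

Lemma namulBl x y z : (x - y) ** z = x ** z - y ** z.
Proof. by rewrite namulDl -scaleN1r namulZl scaleN1r. Qed.

Lemma namulBr x y z : x ** (y - z) = x ** y - x ** z.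
Proof. by rewrite namulDr -scaleN1r namulZr scaleN1r. Qed.

Lemma namul_suml I (r : seq I) (P : pred I) (F : I -> A) y :
  (\sum_(i <- r | P i) F i) ** y = \sum_(i <- r | P i) F i ** y.
Proof.
by apply: (big_morph (fun x => x ** y)) => [u v|]; rewrite ?namulDl ?namul0l.
Qed.

Lemma namul_sumr I (r : seq I) (P : pred I) (F : I -> A) x :
  x ** (\sum_(i <- r | P i) F i) = \sum_(i <- r | P i) x ** F i.
Proof.
by apply: (big_morph (fun y => x ** y)) => [u v|]; rewrite ?namulDr ?namul0r.
Qed.

Definition assoc x y z := x ** (y ** z) - (x ** y) ** z.

Inductive alg_gen (S : A -> Prop) : A -> Prop :=
  | alg_gen_in x : S x -> alg_gen S x
  | alg_gen0 : alg_gen S 0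
  | alg_genD x y : alg_gen S x -> alg_gen S y -> alg_gen S (x + y)
  | alg_genZ c x : alg_gen S x -> alg_gen S (c *: x)
  | alg_genM x y : alg_gen S x -> alg_gen S y -> alg_gen S (x ** y).

Definition fin_gen_subalg (B : A -> Prop) :=
  exists s : seq A, forall x, B x <-> alg_gen (fun y => y \in s) x.

End NonassocTheory.

Inductive namonom (X : Type) := NaVar of X | NaMul of namonom X & namonom X.

Section NamonomChoice.
Variable X : Type.

Fixpoint namonom_enc (m : namonom X) : GenTree.tree X :=
  match m with
  | NaVar x => GenTree.Leaf x
  | NaMul m1 m2 => GenTree.Node 0 [:: namonom_enc m1; namonom_enc m2]
  end.

Fixpoint namonom_dec (t : GenTree.tree X) : option (namonom X) :=
  match t with
  | GenTree.Leaf x => Some (NaVar x)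
  | GenTree.Node _ [:: t1; t2] =>
      if (namonom_dec t1, namonom_dec t2) is (Some m1, Some m2)
      then Some (NaMul m1 m2) else None
  | _ => None
  end.

Lemma namonom_encK : pcancel namonom_enc namonom_dec.
Proof. by elim=> //= m1 -> m2 ->. Qed.
End NamonomChoice.

HB.instance Definition _ (X : eqType) :=
  Equality.copy (namonom X) (pcan_type (@namonom_encK X)).
HB.instance Definition _ (X : choiceType) :=
  Choice.copy (namonom X) (pcan_type (@namonom_encK X)).

Module FreeNonassoc.
Import monalg.

(* The free nonassociative algebra K{X}: finite linear combinations of
   bracketed words in X.  There is no empty word, hence no constant term. *)
Definition free_na (K : nzRingType) (X : choiceType) : Type :=
  {malg K[namonom X]}.

Lemma malgZU (R : nzRingType) (T : choiceType) (c a : R) (m : T) :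
  c *: << a *g m >> = << c * a *g m >> :> {malg R[T]}.
Proof.
apply/malgP => k; rewrite [LHS]mcoeffZ 2!mcoeffU.
by case: (m == k); rewrite // mulr0.
Qed.

HB.lock Definition free_var (K : nzRingType) (X : choiceType) (x : X) :
  free_na K X := << NaVar x >>.

Section Free.
Variable K : fieldType.

HB.instance Definition _ (X : choiceType) := GRing.Lmodule.copy (free_na K X)
  {malg K[namonom X]}.

Section Mul.
Variable X : choiceType.
Implicit Types f g : free_na K X.

Definition free_mul f g : free_na K X :=
  \sum_(m <- msupp f) \sum_(n <- msupp g) << f@_m * g@_n *g NaMul m n >>.

Lemma sum_suppw (V : zmodType) (F : namonom X -> K -> V) f (D : {fset namonom X}) :
  (forall m, F m 0 = 0) -> (msupp f `<=` D)%fset ->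
  \sum_(m <- msupp f) F m f@_m = \sum_(m <- D) F m f@_m.
Proof.
move=> F0 le_fD; rewrite (big_fset_incl _ le_fD) // => m _ /mcoeff_outdom ->.
exact: F0.
Qed.

Lemma sum_suppD (V : zmodType) (F : namonom X -> K -> V) f g :
  (forall m a b, F m (a + b) = F m a + F m b) ->
  \sum_(m <- msupp (f + g : {malg K[namonom X]})) F m (f + g : {malg K[namonom X]})@_m
  = \sum_(m <- msupp f) F m f@_m + \sum_(m <- msupp g) F m g@_m.
Proof.
move=> FD; have F0 m : F m 0 = 0.
  by apply/(addrI (F m 0)); rewrite -FD !addr0.
rewrite (sum_suppw F0 (msuppD_le f g)).
rewrite (sum_suppw F0 (fsubsetUl (msupp f) (msupp g))).
rewrite (sum_suppw F0 (fsubsetUr (msupp f) (msupp g))).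
by rewrite -big_split /=; apply: eq_bigr => m _; rewrite mcoeffD FD.
Qed.

Lemma sum_suppZ (V : zmodType) (F : namonom X -> K -> V) c f :
  (forall m, F m 0 = 0) ->
  \sum_(m <- msupp (c *: f : {malg K[namonom X]})) F m (c *: f : {malg K[namonom X]})@_m
  = \sum_(m <- msupp f) F m (c * f@_m).
Proof.
move=> F0; rewrite (sum_suppw F0 (msuppZ_le c f)).
by apply: eq_bigr => m _; rewrite mcoeffZ.
Qed.

Lemma free_mulDl f g h : free_mul (f + g) h = free_mul f h + free_mul g h.
Proof.
pose F m a := \sum_(n <- msupp h) << a * h@_n *g NaMul m n >> : free_na K X.
rewrite /free_mul; apply: (sum_suppD (F := F)) => m a b.
by rewrite -big_split /=; apply: eq_bigr => n _; rewrite mulrDl monalgUD.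
Qed.

Lemma free_mulDr f g h : free_mul f (g + h) = free_mul f g + free_mul f h.
Proof.
rewrite /free_mul -big_split /=; apply: eq_bigr => m _.
pose F n a := << f@_m * a *g NaMul m n >> : free_na K X.
by apply: (sum_suppD (F := F)) => n a b; rewrite /F mulrDr monalgUD.
Qed.

Lemma free_mulZl c f g : free_mul (c *: f) g = c *: free_mul f g.
Proof.
pose F m a := \sum_(n <- msupp g) << a * g@_n *g NaMul m n >> : free_na K X.
rewrite /free_mul (sum_suppZ (F := F)) /F => [|m].
  rewrite scaler_sumr; apply: eq_bigr => m _.
  by rewrite scaler_sumr; apply: eq_bigr => n _; rewrite malgZU mulrA.
by rewrite big1 // => n _; rewrite mul0r monalgU0.
Qed.

Lemma free_mulZr c f g : free_mul f (c *: g) = c *: free_mul f g.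
Proof.
rewrite /free_mul scaler_sumr; apply: eq_bigr => m _.
pose F n a := << f@_m * a *g NaMul m n >> : free_na K X.
rewrite (sum_suppZ (F := F)) /F => [|n]; last by rewrite mulr0 monalgU0.
by rewrite scaler_sumr; apply: eq_bigr => n _; rewrite malgZU mulrCA.
Qed.
End Mul.

HB.instance Definition _ (X : choiceType) :=
  Lmodule_isNonassocAlgebra.Build K (free_na K X)
    (@free_mulDl X) (@free_mulDr X) (@free_mulZl X) (@free_mulZr X).


Section Eval.
Variables (X : choiceType) (A : nonassocAlgType K) (a : X -> A).

Fixpoint na_eval_monom (m : namonom X) : A :=
  match m with
  | NaVar x => a x
  | NaMul m1 m2 => na_eval_monom m1 ** na_eval_monom m2
  end.

Definition na_eval (f : free_na K X) : A :=
  \sum_(m <- msupp f) f@_m *: na_eval_monom m.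

Lemma na_evalU c m : na_eval << c *g m >> = c *: na_eval_monom m.
Proof.
rewrite /na_eval (@sum_suppw _ _ (fun m b => b *: na_eval_monom m) _ [fset m]%fset).
- by rewrite big_seq_fset1 mcoeffUU.
- by move=> k; rewrite scale0r.
- exact: msuppU_le.
Qed.

Lemma na_eval_var x : na_eval (free_var K x) = a x.
Proof. by rewrite unlock na_evalU scale1r. Qed.

Lemma na_evalD f g : na_eval (f + g) = na_eval f + na_eval g.
Proof.
apply: (sum_suppD (F := fun m b => b *: na_eval_monom m)) => m b c.
exact: scalerDl.
Qed.

Lemma na_evalZ c f : na_eval (c *: f) = c *: na_eval f.
Proof.
rewrite /na_eval (sum_suppZ (F := fun m b => b *: na_eval_monom m)) => [|m].
  by rewrite scaler_sumr; apply: eq_bigr => m _; rewrite scalerA.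
exact: scale0r.
Qed.

Lemma na_evalN f : na_eval (- f) = - na_eval f.
Proof. by rewrite -scaleN1r na_evalZ scaleN1r. Qed.

Lemma na_eval0 : na_eval 0 = 0.
Proof. by rewrite -(scale0r 0) na_evalZ scale0r. Qed.

Lemma na_eval_sum I (r : seq I) (P : pred I) (F : I -> free_na K X) :
  na_eval (\sum_(i <- r | P i) F i) = \sum_(i <- r | P i) na_eval (F i).
Proof. exact: (big_morph na_eval na_evalD na_eval0). Qed.

Lemma na_evalM f g : na_eval (f ** g) = na_eval f ** na_eval g.
Proof.
rewrite [f ** g]/(free_mul f g) na_eval_sum [in RHS]/na_eval namul_suml.
apply: eq_bigr => m _; rewrite na_eval_sum namul_sumr.
by apply: eq_bigr => n _; rewrite na_evalU namulZl namulZr scalerA.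
Qed.
End Eval.

Lemma free_na_monomE (X : choiceType) (m : namonom X) :
  << m >> = na_eval_monom (@free_var K X) m.
Proof.
elim: m => [x|m1 /= <- m2 <-]; first by rewrite unlock.
rewrite [RHS]/(free_mul _ _) /free_mul.
rewrite !msuppU oner_eq0 !big_seq_fset1 !mcoeffUU mulr1 //.
Qed.

Lemma na_eval_varE (X : choiceType) (f : free_na K X) :
  na_eval (@free_var K X) f = f.
Proof.
rewrite /na_eval [RHS]monalgE; apply: eq_bigr => m _.
by rewrite -free_na_monomE malgZU mulr1.
Qed.

Lemma na_eval_comp (X : choiceType) (A B : nonassocAlgType K) (a : X -> A)
    (phi : A -> B) (f : free_na K X) :
  {morph phi : x y / x + y} -> (forall c, {morph phi : x / c *: x}) ->
  {morph phi : x y / x ** y} ->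
  phi (na_eval a f) = na_eval (phi \o a) f.
Proof.
move=> phiD phiZ phiM; rewrite /na_eval.
have phi0 : phi 0 = 0 by rewrite -(scale0r 0) phiZ scale0r.
rewrite (big_morph phi phiD phi0); apply: eq_bigr => m _; rewrite phiZ.
by congr (_ *: _); elim: m => //= m1 <- m2 <-; rewrite phiM.
Qed.

End Free.
End FreeNonassoc.
Export FreeNonassoc.
Import mpoly.

Section Varieties.
Variable K : fieldType.

Definition variety (S : free_na K nat -> Prop) (A : nonassocAlgType K) : Prop :=
  forall f, S f -> forall a : nat -> A, na_eval a f = 0.

Definition is_variety (V : nonassocAlgType K -> Prop) : Prop :=
  exists S, forall A, V A <-> variety S A.

(* The T-ideal of V in the variables X: the polynomial identities in X that
   hold in every algebra of V. *)
Definition tideal (V : nonassocAlgType K -> Prop) (X : choiceType) :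
    {pred free_na K X} := fun f => `[< forall A : nonassocAlgType K, V A ->
                 forall a : X -> A, na_eval a f = 0 >].
Arguments tideal : clear implicits.

Section RelFree.
Variables (V : nonassocAlgType K -> Prop) (X : choiceType).
Local Notation I := (tideal V X).

Lemma tidealP f : reflect (forall A : nonassocAlgType K, V A ->
  forall a : X -> A, na_eval a f = 0) (f \in I).
Proof. exact: asboolP. Qed.

Lemma tideal_zmod_closed : zmod_closed I.
Proof.
split=> [|f g /tidealP If /tidealP Ig]; apply/tidealP => A VA a.
  exact: na_eval0.
by rewrite na_evalD na_evalN If // Ig // subr0.
Qed.

HB.instance Definition _ := GRing.isZmodClosed.Build _ (tideal V X)
  tideal_zmod_closed.

Lemma tidealZ c f : f \in I -> c *: f \in I.
Proof.
by move=> /tidealP If; apply/tidealP => A VA a; rewrite na_evalZ If // scaler0.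
Qed.

Lemma tidealMl f g : g \in I -> f ** g \in I.
Proof.
by move=> /tidealP Ig; apply/tidealP => A VA a; rewrite na_evalM Ig // namul0r.
Qed.

Lemma tidealMr f g : f \in I -> f ** g \in I.
Proof.
by move=> /tidealP If; apply/tidealP => A VA a; rewrite na_evalM If // namul0l.
Qed.

Definition relfree : Type := {ideal_quot tideal V X}.
HB.instance Definition _ := GRing.Zmodule.on relfree.
HB.instance Definition _ := EqQuotient.on relfree.

Implicit Types u v w : relfree.

Definition relfree_scale (c : K) u : relfree := \pi_relfree (c *: repr u).
Definition relfree_mul u v : relfree := \pi_relfree (repr u ** repr v).

Lemma relfree_eq (f g : free_na K X) :
  \pi_relfree f = \pi_relfree g <-> f - g \in I.
Proof. by rewrite Quotient.idealrBE; split=> [/eqP|/eqP]. Qed.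

Lemma relfree_piD (f g : free_na K X) :
  \pi_relfree (f + g) = \pi_relfree f + \pi_relfree g.
Proof. by rewrite [LHS]Quotient.pi_add. Qed.

Lemma relfree_pi0 : \pi_relfree 0 = 0.
Proof. by apply: (addrI (\pi_relfree 0)); rewrite -relfree_piD !addr0. Qed.

Lemma relfree_repr (f : free_na K X) : repr (\pi_relfree f) - f \in I.
Proof. by apply/relfree_eq; rewrite reprK. Qed.

Lemma relfree_piZ c f : \pi_relfree (c *: f) = relfree_scale c (\pi_relfree f).
Proof.
by apply/esym/relfree_eq; rewrite -scalerBr; apply/tidealZ/relfree_repr.
Qed.

Lemma tidealBM (f f' g g' : free_na K X) :
  f' - f \in I -> g' - g \in I -> f' ** g' - f ** g \in I.
Proof.
move=> If Ig; have -> : f' ** g' - f ** g = f' ** (g' - g) + (f' - f) ** g.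
  by rewrite namulBr namulBl addrA subrK.
by apply: rpredD; [apply: tidealMl | apply: tidealMr].
Qed.

Lemma relfree_piM f g :
  \pi_relfree (f ** g) = relfree_mul (\pi_relfree f) (\pi_relfree g).
Proof. by apply/esym/relfree_eq/tidealBM; apply: relfree_repr. Qed.

Lemma relfree_ind (P : relfree -> Prop) :
  (forall f, P (\pi_relfree f)) -> forall u, P u.
Proof. by move=> Ppi u; rewrite -[u]reprK. Qed.

Lemma relfree_scaleA a b u :
  relfree_scale a (relfree_scale b u) = relfree_scale (a * b) u.
Proof. by elim/relfree_ind: u => f; rewrite -!relfree_piZ scalerA. Qed.

Lemma relfree_scale1 : left_id 1 relfree_scale.
Proof. by elim/relfree_ind => f; rewrite -relfree_piZ scale1r. Qed.

Lemma relfree_scaleDr : right_distributive relfree_scale +%R.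
Proof.
move=> c; elim/relfree_ind => f; elim/relfree_ind => g.
by rewrite -relfree_piD -!relfree_piZ scalerDr relfree_piD.
Qed.

Lemma relfree_scaleDl u : {morph relfree_scale^~ u : a b / a + b}.
Proof.
elim/relfree_ind: u => f a b.
by rewrite /= -!relfree_piZ scalerDl relfree_piD.
Qed.

HB.instance Definition _ := GRing.Zmodule_isLmodule.Build K relfree
  relfree_scaleA relfree_scale1 relfree_scaleDr relfree_scaleDl.

Lemma relfree_mulDl u v w :
  relfree_mul (u + v) w = relfree_mul u w + relfree_mul v w.
Proof.
elim/relfree_ind: u => f; elim/relfree_ind: v => g; elim/relfree_ind: w => h.
by rewrite -relfree_piD -!relfree_piM namulDl relfree_piD.
Qed.

Lemma relfree_mulDr u v w :
  relfree_mul u (v + w) = relfree_mul u v + relfree_mul u w.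
Proof.
elim/relfree_ind: u => f; elim/relfree_ind: v => g; elim/relfree_ind: w => h.
by rewrite -relfree_piD -!relfree_piM namulDr relfree_piD.
Qed.

Lemma relfree_mulZl c u v : relfree_mul (c *: u) v = c *: relfree_mul u v.
Proof.
elim/relfree_ind: u => f; elim/relfree_ind: v => g.
rewrite -![_ *: _]/(relfree_scale _ _).
by rewrite -relfree_piM -!relfree_piZ -relfree_piM namulZl.
Qed.

Lemma relfree_mulZr c u v : relfree_mul u (c *: v) = c *: relfree_mul u v.
Proof.
elim/relfree_ind: u => f; elim/relfree_ind: v => g.
rewrite -![_ *: _]/(relfree_scale _ _).
by rewrite -relfree_piM -!relfree_piZ -relfree_piM namulZr.
Qed.

HB.instance Definition _ := Lmodule_isNonassocAlgebra.Build K relfree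
  relfree_mulDl relfree_mulDr relfree_mulZl relfree_mulZr.

Definition relfree_var (x : X) : relfree := \pi_relfree (free_var K x).

Lemma relfree_eval_pi (Y : choiceType) (b : Y -> free_na K X) f :
  na_eval (fun y => \pi_relfree (b y)) f = \pi_relfree (na_eval b f).
Proof.
symmetry; apply: na_eval_comp => [g h|c g|g h].
- exact: relfree_piD.
- exact: relfree_piZ.
- exact: relfree_piM.
Qed.

End RelFree.

Lemma relfree_eval_tideal (V : nonassocAlgType K -> Prop) (X Y : choiceType)
    (b : Y -> relfree V X) f : f \in tideal V Y -> na_eval b f = 0.
Proof.
move=> /tidealP If.
have -> : b = fun y => \pi_(relfree V X) (repr (b y)).
  by apply: funext => y; rewrite reprK.
rewrite relfree_eval_pi -[0]reprK; apply/relfree_eq.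
have I0 : repr (0 : relfree V X) \in tideal V X.
  by rewrite -[repr _]subr0; apply/relfree_eq; rewrite reprK relfree_pi0.
rewrite rpredB //; apply/tidealP => A VA a.
rewrite (@na_eval_comp _ _ _ _ _ (na_eval a)) ?If //.
- exact: na_evalD.
- exact: na_evalZ.
- exact: na_evalM.
Qed.

Section Subst.
Variables (V : nonassocAlgType K -> Prop) (X : choiceType).

(* The value f(b) of f in F(V), computed on a representative of f in K{X}. *)
Definition relfree_subst (b : X -> relfree V X) (u : relfree V X) :
  relfree V X := na_eval b (repr u).

Lemma relfree_substE b f :
  relfree_subst b (\pi_(relfree V X) f) = na_eval b f.
Proof.
apply/eqP; rewrite -subr_eq0 -na_evalN -na_evalD; apply/eqP.
exact/relfree_eval_tideal/relfree_repr.
Qed.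

End Subst.

Definition Lvar_ids : free_na K nat -> Prop :=
  let x1 := free_var K 1%N in let x2 := free_var K 2%N in
  let x3 := free_var K 3%N in
  fun f => f = assoc x1 x2 x3 - assoc x1 x3 x2 \/ f = x1 ** (x2 ** x3).

Definition Lvar : nonassocAlgType K -> Prop := variety Lvar_ids.

Lemma LvarP (A : nonassocAlgType K) :
  Lvar A <-> (forall x y z : A, assoc x y z = assoc x z y) /\
             (forall x y z : A, x ** (y ** z) = 0).
Proof.
split=> [LA|[rs l0] f [] -> a]; last first.
- by rewrite !na_evalM !na_eval_var l0.
- rewrite /assoc !(na_evalD, na_evalN, na_evalM) !na_eval_var.
  by apply/eqP; rewrite subr_eq0; apply/eqP/rs.
pose a x y z n : A := if n is 1%N then x else if n is 2%N then y else z.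
split=> x y z.
  have := LA _ (or_introl erefl) (a x y z).
  rewrite /assoc !(na_evalD, na_evalN, na_evalM) !na_eval_var /= => /eqP.
  by rewrite subr_eq0 => /eqP.
by have := LA _ (or_intror erefl) (a x y z); rewrite !na_evalM !na_eval_var.
Qed.

End Varieties.

Section LinearGroup.
Variables (K : fieldType) (d : nat).

Definition GL_subgroup (G : 'M[K]_d -> Prop) : Prop :=
  [/\ forall g, G g -> g \in unitmx,
      G 1%:M,
      forall g h, G g -> G h -> G (g *m h)
    & forall g, G g -> G (invmx g)].

(* The j-th column of g holds the coordinates of g(x_j) in the basis X_d. *)
Definition gl_relfree (V : nonassocAlgType K -> Prop) (g : 'M[K]_d)
    (u : relfree V 'I_d) : relfree V 'I_d :=
  relfree_subst (fun j => \sum_(i < d) g i j *: relfree_var V i) u.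

Definition gl_mpoly (g : 'M[K]_d) (p : {mpoly K[d]}) : {mpoly K[d]} :=
  comp_mpoly [tuple \sum_(i < d) g i j *: 'X_i | j < d] p.

Definition relfree_fix (V : nonassocAlgType K -> Prop) (G : 'M[K]_d -> Prop)
    (u : relfree V 'I_d) : Prop := forall g, G g -> gl_relfree g u = u.

Definition mpoly_fix (G : 'M[K]_d -> Prop) (p : {mpoly K[d]}) : Prop :=
  forall g, G g -> gl_mpoly g p = p.

Definition mpoly_aug (p : {mpoly K[d]}) : Prop := p@_0%MM = 0.

(* The square of the ideal A_d; see mpoly_aug2P for the description by degrees. *)
Definition mpoly_aug2 (p : {mpoly K[d]}) : Prop :=
  exists s : seq ({mpoly K[d]} * {mpoly K[d]}),
    (forall u, u \in s -> mpoly_aug u.1 /\ mpoly_aug u.2) /\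
    p = \sum_(u <- s) u.1 * u.2.

Lemma mpoly_aug2P (p : {mpoly K[d]}) :
  mpoly_aug2 p <-> forall m : 'X_{1..d}, (mdeg m < 2)%N -> p@_m = 0.
Proof.
split=> [[s [sA ->]] m m2|p2].
  rewrite raddf_sum big_seq big1 // => -[p1 p2] /sA [/= p10 p20].
  rewrite mcoeffM big1 // => -[m1 m2'] /= /eqP Em.
  have {}m2 : (mdeg m1 + mdeg m2' < 2)%N by rewrite -mdegD -Em.
  have [->|n1] := eqVneq (m1 : 'X_{1..d}) 0%MM; first by rewrite p10 mul0r.
  have [->|n2] := eqVneq (m2' : 'X_{1..d}) 0%MM; first by rewrite p20 mulr0.
  have n12 : (1 + 1 <= mdeg m1 + mdeg m2')%N.
    by rewrite leq_add // lt0n mdeg_eq0.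
  by rewrite leqNgt m2 in n12.
have [f fP] : exists f : 'X_{1..d} -> 'X_{1..d} * 'X_{1..d},
    forall m, (1 < mdeg m)%N ->
      [/\ (f m).1 != 0%MM, (f m).2 != 0%MM & ((f m).1 + (f m).2)%MM = m].
  suff /boolp.choice [f fP] : forall m : 'X_{1..d}, exists w : 'X_{1..d} * 'X_{1..d},
      (1 < mdeg m)%N -> [/\ w.1 != 0%MM, w.2 != 0%MM & (w.1 + w.2)%MM = m].
    by exists f.
  move=> m; have [m2|] := boolP (1 < mdeg m)%N; last by exists (m, m).
  have [i mi] : exists i, m i != 0%N.
    apply: contrapT => /forallNP m0; move: m2; rewrite mdegE big1 // => i _.
    by apply/eqP/negPn/negP/m0.
  have le_im : (U_(i) <= m)%MM by rewrite lep1mP.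
  exists (U_(i), m - U_(i))%MM => _ /=; split; last by rewrite addmC submK.
    by rewrite -mdeg_eq0 mdeg1.
  rewrite -mdeg_eq0; move: m2.
  by rewrite -{1}(submK le_im) mdegD mdeg1 addn1; case: (mdeg _).
exists [seq (p@_m *: 'X_[(f m).1], 'X_[(f m).2]) | m <- msupp p]; split.
  move=> u /mapP [m mp ->] /=.
  have m2 : (1 < mdeg m)%N.
    rewrite ltnNge; apply/negP => /p2 /eqP; apply/negP.
    by rewrite mcoeff_msupp in mp *.
  have [n1 n2 _] := fP m m2; rewrite /mpoly_aug mcoeffZ !mcoeffX.
  by rewrite (negPf n1) (negPf n2) mulr0.
rewrite big_map [LHS]mpolyE big_seq [RHS]big_seq; apply: eq_bigr => m mp /=.
have m2 : (1 < mdeg m)%N.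
  rewrite ltnNge; apply/negP => /p2 /eqP; apply/negP.
  by rewrite mcoeff_msupp in mp *.
by have [_ _ Em] := fP m m2; rewrite -scalerAl -mpolyXD Em.
Qed.

Definition mpoly_aug2_fix (G : 'M[K]_d -> Prop) (p : {mpoly K[d]}) : Prop :=
  mpoly_aug2 p /\ mpoly_fix G p.

Definition linear_fix (G : 'M[K]_d -> Prop) (p : {mpoly K[d]}) : Prop :=
  p \is 1.-homog /\ mpoly_fix G p.

Inductive unital_subalg (S : {mpoly K[d]} -> Prop) : {mpoly K[d]} -> Prop :=
  | unital_subalg_in p : S p -> unital_subalg S p
  | unital_subalg_const c : unital_subalg S c%:MP
  | unital_subalgD p q :
      unital_subalg S p -> unital_subalg S q -> unital_subalg S (p + q)
  | unital_subalgM p q :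
      unital_subalg S p -> unital_subalg S q -> unital_subalg S (p * q).

End LinearGroup.

Definition fin_gen_submod (B : comNzRingType) (R M : B -> Prop) : Prop :=
  exists s : seq B, (forall b, b \in s -> M b) /\
    forall b, M b ->
      exists r : 'I_(size s) -> B, (forall i, R (r i)) /\
        b = \sum_(i < size s) r i * s`_i.

(* Main.v *)
Require Import Defs.
From HB Require Import structures.
From mathcomp Require Import all_boot all_order all_algebra.
From mathcomp Require Import generic_quotient boolp ring.
From mathcomp Require Import mpoly.

(** Make K[X_d] a nonassociative algebra A by p . q = (p - p(0)) lin(q), where
    lin(q) is the linear part of q.  As a product has neither constant nor
    linear part, x (y z) = 0 in A, and (x y) z = (x - x(0)) lin(y) lin(z) is
    symmetric in y and z; hence A lies in the variety L, so in V, and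
    x_i |-> x_i extends to a homomorphism [topoly] from F_d(V) to A, which
    commutes with GL_d because constant and linear parts do.

    Every invariant without constant term is still the image of an invariant
    ([topoly_onto]).  In characteristic 0 a form p of degree n has the full
    polarization
      (1/n!) sum (d_{i_1} ... d_{i_n} p) (..(x_{i_n} x_{i_{n-1}}) ..) x_{i_1}
    in F_d(V), with left-normed products.  By the chain rule polarization
    commutes with GL_d, so it sends invariants to invariants, and by Euler's
    formula it is a section of [topoly] ([gl_polar], [topoly_polar]).

    Finally, suppose that F_d(V)^G is generated by s, so that the invariants
    without constant term lie in the subalgebra of A generated by the
    p_i = topoly(s_i).  In this subalgebra, multiplying on the right is
    multiplying by an invariant linear form, so it is small ([lpoly_gen]): the
    linear part of any of its elements is a combination of the l_i = lin(p_i)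
    with coefficients in K, and the part of degree at least 2 is a combination
    of the p_i - p_i(0) - l_i and the l_i l_j with coefficients in the ring
    generated by the l_i.  An element of (A_d^2)^G is its own part of degree at
    least 2, so these finitely many elements of (A_d^2)^G generate it as a
    module over K[(A_d)_1^G]. *)

Set Implicit Arguments.
Unset Strict Implicit.
Unset Printing Implicit Defensive.

Import GRing.Theory.
Local Open Scope ring_scope.
Local Open Scope quotient_scope.

(** * Linear combinations with coefficients in a subring *)

Section LinComb.
Variables (B : comNzRingType) (R : B -> Prop).
Hypotheses (R0 : R 0) (R1 : R 1).
Hypotheses (RD : forall x y, R x -> R y -> R (x + y)).
Hypotheses (RM : forall x y, R x -> R y -> R (x * y)).
Implicit Types (s : seq B) (b x y : B).

(** The coefficients are a function on the positions in s, as in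
    [fin_gen_submod]. *)
Definition lin_comb s b := exists r : 'I_(size s) -> B,
  (forall i, R (r i)) /\ b = \sum_(i < size s) r i * s`_i.

Lemma lin_comb0 s : lin_comb s 0.
Proof.
by exists (fun=> 0); split=> //; rewrite big1 // => i _; rewrite mul0r.
Qed.

Lemma lin_combD s x y : lin_comb s x -> lin_comb s y -> lin_comb s (x + y).
Proof.
move=> [r [rR ->]] [t [tR ->]]; exists (fun i => r i + t i).
split=> [i|]; first exact: RD.
by rewrite -big_split; apply: eq_bigr => i _; rewrite mulrDl.
Qed.

Lemma lin_combM s c x : R c -> lin_comb s x -> lin_comb s (c * x).
Proof.
move=> cR [r [rR ->]]; exists (fun i => c * r i); split=> [i|]; first exact: RM.
by rewrite big_distrr; apply: eq_bigr => i _; rewrite /= mulrA.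
Qed.

Lemma lin_comb_mem s x : x \in s -> lin_comb s x.
Proof.
move=> xs; exists (fun i => (i == index x s :> nat)%:R); split=> [i|].
  by case: eqP.
have xs_lt : (index x s < size s)%N by rewrite index_mem.
rewrite (bigD1 (Ordinal xs_lt)) //= eqxx mul1r nth_index // big1 ?addr0 // => i.
by rewrite -val_eqE /= => /negPf ->; rewrite mul0r.
Qed.

Lemma lin_comb_sum s (I : Type) (r : seq I) (F : I -> B) :
  (forall i, lin_comb s (F i)) -> lin_comb s (\sum_(i <- r) F i).
Proof.
move=> FR; elim/big_ind: _ => // [|x y]; [exact: lin_comb0 | exact: lin_combD].
Qed.

Lemma lin_comb_mul s t x y : lin_comb s x -> lin_comb t y ->
  lin_comb [seq a * b | a <- s, b <- t] (x * y).
Proof.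
move=> [r [rR ->]] [u [uR ->]]; rewrite mulr_suml.
apply: lin_comb_sum => i; rewrite mulr_sumr; apply: lin_comb_sum => j.
rewrite mulrACA; apply/lin_combM/lin_comb_mem/allpairs_f; first exact: RM.
  exact: mem_nth.
exact: mem_nth.
Qed.

End LinComb.

Lemma lin_comb_sub (B : comNzRingType) (R R' : B -> Prop) (s t : seq B) x :
  R' 0 -> R' 1 -> (forall x y, R' x -> R' y -> R' (x + y)) ->
  (forall x y, R' x -> R' y -> R' (x * y)) ->
  (forall r, R r -> R' r) -> {subset s <= t} ->
  lin_comb R s x -> lin_comb R' t x.
Proof.
move=> R0 R1 RD RM RR' st [r [rR ->]]; apply: lin_comb_sum => // i.
by apply: lin_combM (RR' _ (rR i)) _ => //; apply/lin_comb_mem/st/mem_nth.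
Qed.

(** * Linear substitutions and the linear part of a polynomial *)

Section LinearPart.
Variables (K : fieldType) (d : nat).
Local Notation P := {mpoly K[d]}.
Implicit Types (p q : P) (g : 'M[K]_d).

(** Identities compatible with sums and products, such as the chain rule, have
    to be checked only on the generators of K[X_d]. *)
Lemma mpoly_alg_ind (Q : P -> Prop) :
  (forall c, Q c%:MP) -> (forall i, Q 'X_i) ->
  (forall p q, Q p -> Q q -> Q (p + q)) ->
  (forall p q, Q p -> Q q -> Q (p * q)) -> forall p, Q p.
Proof.
move=> QC QX QD QM p; rewrite [p]mpolyE.
have Q1 : Q 1 by exact: (QC 1).
apply: (big_ind Q); [exact: (QC 0) | exact: QD | move=> m _].
rewrite -mul_mpolyC mpolyXE_id; apply: (QM); first exact: QC.
apply: (big_ind Q); [exact: Q1 | exact: QM | move=> i _].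
by elim: (m i) => [|k IH]; rewrite ?expr0 // exprS; apply: QM.
Qed.

Definition linear_part p : P := \sum_i p@_U_(i) *: 'X_i.

(** The component of p in degrees at least 2. *)
Definition nonlinear_part p : P := p - (p@_0%MM)%:MP - linear_part p.

Lemma linD p q : linear_part (p + q) = linear_part p + linear_part q.
Proof.
by rewrite -big_split; apply: eq_bigr => i _; rewrite mcoeffD scalerDl.
Qed.

Lemma linZ c p : linear_part (c *: p) = c *: linear_part p.
Proof.
by rewrite scaler_sumr; apply: eq_bigr => i _; rewrite mcoeffZ scalerA.
Qed.

Lemma lin_coef0 p : (linear_part p)@_0%MM = 0.
Proof.
rewrite raddf_sum big1 // => i _ /=; rewrite mcoeffZ mcoeffX.
by rewrite -mdeg_eq0 mdeg1 mulr0.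
Qed.

Lemma lin_coef1 p i : (linear_part p)@_U_(i) = p@_U_(i).
Proof.
rewrite raddf_sum (bigD1 i) //= big1 ?addr0 => [|j neq_ji].
  by rewrite mcoeffZ mcoeffX eqxx mulr1.
rewrite mcoeffZ mcoeffX; case: eqP => [E|]; last by rewrite mulr0.
by move/mnmP/(_ i): E; rewrite !mnm1E eqxx (negPf neq_ji).
Qed.

Lemma lin_X i : linear_part 'X_i = 'X_i.
Proof.
rewrite /linear_part (bigD1 i) //= big1 ?addr0 => [|j neq_ji].
  by rewrite mcoeffX eqxx scale1r.
rewrite mcoeffX; case: eqP => [E|]; last by rewrite scale0r.
by move/mnmP/(_ j): E; rewrite !mnm1E eqxx eq_sym (negPf neq_ji).
Qed.

Lemma lin_homog p : linear_part p \is 1.-homog.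
Proof.
by apply: rpred_sum => i _; apply: dhomogZ; rewrite dhomogX; apply/eqP/mdeg1.
Qed.

Lemma lin_aug2 p : mpoly_aug2 p -> linear_part p = 0.
Proof.
move=> /mpoly_aug2P p2; rewrite /linear_part big1 // => i _.
by rewrite p2 ?scale0r // mdeg1.
Qed.

Lemma nonlin_aug2 p : mpoly_aug2 (nonlinear_part p).
Proof.
apply/mpoly_aug2P => m; rewrite ltnS leq_eqVlt ltnS leqn0.
rewrite /nonlinear_part !mcoeffB mcoeffC => /orP[/mdeg1P[i /eqP->]|].
  by rewrite lin_coef1 -mdeg_eq0 mdeg1 mulr0 subr0 subrr.
by rewrite mdeg_eq0 => /eqP->; rewrite lin_coef0 eqxx mulr1 subrr subr0.
Qed.

Lemma nonlin_id p : mpoly_aug2 p -> nonlinear_part p = p.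
Proof.
move=> p2; rewrite /nonlinear_part lin_aug2 //; move/mpoly_aug2P: p2 => ->.
  by rewrite mpolyC0 !subr0.
by rewrite mdeg0.
Qed.

Lemma gl_mpolyX g j : gl_mpoly g 'X_j = \sum_i g i j *: 'X_i.
Proof. by rewrite /gl_mpoly comp_mpolyXU -tnth_nth tnth_mktuple. Qed.

HB.instance Definition _ g := GRing.RMorphism.copy (gl_mpoly g)
  (comp_mpoly [tuple \sum_(i < d) g i j *: 'X_i | j < d]).
HB.instance Definition _ g := GRing.Linear.copy (gl_mpoly g)
  (comp_mpoly [tuple \sum_(i < d) g i j *: 'X_i | j < d]).

Lemma gl_mpolyC g c : gl_mpoly g c%:MP = c%:MP.
Proof. exact: comp_mpolyC. Qed.

Lemma gl_mpoly_coef0 g p : (gl_mpoly g p)@_0%MM = p@_0%MM.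
Proof.
elim/mpoly_alg_ind: p => [c|j|p q IHp IHq|p q IHp IHq].
- by rewrite gl_mpolyC.
- rewrite gl_mpolyX raddf_sum big1 => [|i _] /=.
    by rewrite mcoeffX -mdeg_eq0 mdeg1.
  by rewrite mcoeffZ mcoeffX -mdeg_eq0 mdeg1 mulr0.
- by rewrite (rmorphD (gl_mpoly g)) !mcoeffD IHp IHq.
- by rewrite (rmorphM (gl_mpoly g)) !(rmorphM (mcoeff _)) /= IHp IHq.
Qed.

(** The chain rule.  Both sides are derivations along the endomorphism g, so it
    is enough to compare them on the variables. *)
Lemma mderiv_gl_mpoly g p i :
  (gl_mpoly g p)^`M(i) = \sum_j g i j *: gl_mpoly g p^`M(j).
Proof.
elim/mpoly_alg_ind: p => [c|k|p q IHp IHq|p q IHp IHq].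
- rewrite gl_mpolyC mderivC big1 // => j _.
  by rewrite mderivC raddf0 scaler0.
- rewrite gl_mpolyX raddf_sum /=.
  have dX a b : ('X_a : P)^`M(b) = (a == b)%:R.
    rewrite mderivX mnm1E; case: eqP => [->|_]; last by rewrite scale0r.
    by rewrite scale1r -{1}[U_(b)%MM]add0m addmK mpolyX0.
  rewrite (bigD1 i) // [RHS](bigD1 k) //=.
  rewrite big1 ?addr0 => [|j /negPf neq_ji]; last first.
    by rewrite mderivZ dX neq_ji scaler0.
  rewrite big1 ?addr0 => [|j /negPf neq_jk]; last first.
    by rewrite dX eq_sym neq_jk raddf0 scaler0.
  by rewrite mderivZ !dX !eqxx (rmorph1 (gl_mpoly g)).
- rewrite (rmorphD (gl_mpoly g)) mderivD IHp IHq -big_split.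
  apply: eq_bigr => j _ /=.
  by rewrite mderivD rmorphD scalerDr.
- rewrite (rmorphM (gl_mpoly g)) mderivM IHp IHq mulr_suml mulr_sumr -big_split.
  apply: eq_bigr => j _ /=.
  by rewrite mderivM rmorphD !rmorphM scalerDr /= -scalerAl -scalerAr.
Qed.

Lemma mderiv_coef0 p i : (p^`M(i))@_0%MM = p@_U_(i).
Proof. by rewrite mcoeff_mderiv mnm0E mulr1n add0m. Qed.

Lemma gl_mpoly_coef1 g p i :
  (gl_mpoly g p)@_U_(i) = \sum_j g i j * p@_U_(j).
Proof.
rewrite -mderiv_coef0 mderiv_gl_mpoly raddf_sum; apply: eq_bigr => j _ /=.
by rewrite mcoeffZ gl_mpoly_coef0 mderiv_coef0.
Qed.

(** The coefficients of the linear part are the partial derivatives at 0, and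
    the chain rule transforms them by g since g fixes 0. *)
Lemma lin_gl_mpoly g p :
  linear_part (gl_mpoly g p) = gl_mpoly g (linear_part p).
Proof.
rewrite [in RHS]/linear_part raddf_sum /=.
under [RHS]eq_bigr => j _ do rewrite linearZ /= gl_mpolyX scaler_sumr.
rewrite exchange_big; apply: eq_bigr => i _ /=.
rewrite gl_mpoly_coef1 scaler_suml; apply: eq_bigr => j _.
by rewrite scalerA mulrC.
Qed.

Lemma nonlin_gl_mpoly g p :
  nonlinear_part (gl_mpoly g p) = gl_mpoly g (nonlinear_part p).
Proof.
by rewrite /nonlinear_part !raddfB /= gl_mpolyC gl_mpoly_coef0 lin_gl_mpoly.
Qed.

End LinearPart.

(** * An algebra of the variety L on the space of polynomials *)

(** A copy of the space of polynomials, to carry the product [lmul] below. *)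
Definition lpoly (K : fieldType) (d : nat) : Type := {mpoly K[d]}.
HB.instance Definition _ K d := GRing.Lmodule.copy (lpoly K d) {mpoly K[d]}.

Section Lpoly.
Variables (K : fieldType) (d : nat).
Implicit Types (p q r : {mpoly K[d]}).

(** Removing the constant term of the left factor keeps products in degrees at
    least 2; this is what makes x (y z) vanish on all polynomials, including
    those with a constant term. *)
Definition lmul p q : {mpoly K[d]} := (p - (p@_0%MM)%:MP) * linear_part q.

Lemma lmulDl p q r : lmul (p + q) r = lmul p r + lmul q r.
Proof. by rewrite /lmul -mulrDl mcoeffD mpolyCD opprD addrACA. Qed.

Lemma lmulDr p q r : lmul p (q + r) = lmul p q + lmul p r.
Proof. by rewrite /lmul linD mulrDr. Qed.

Lemma lmulZl c p q : lmul (c *: p) q = c *: lmul p q.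
Proof. by rewrite /lmul mcoeffZ mpolyCM mul_mpolyC -scalerBr scalerAl. Qed.

Lemma lmulZr c p q : lmul p (c *: q) = c *: lmul p q.
Proof. by rewrite /lmul linZ scalerAr. Qed.

HB.instance Definition _ := Lmodule_isNonassocAlgebra.Build K (lpoly K d)
  lmulDl lmulDr lmulZl lmulZr.

Lemma lmul_coef0 p q : (lmul p q)@_0%MM = 0.
Proof. by rewrite /lmul (rmorphM (mcoeff _)) /= lin_coef0 mulr0. Qed.

Lemma lmul_aug2 p q : mpoly_aug2 (lmul p q).
Proof.
exists [:: (p - (p@_0%MM)%:MP, linear_part q)]; split; last by rewrite big_seq1.
move=> u; rewrite inE => /eqP-> /=; split; last exact: lin_coef0.
by rewrite /mpoly_aug mcoeffB mcoeffC eqxx mulr1 subrr.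
Qed.

Lemma lin_lmul p q : linear_part (lmul p q) = 0.
Proof. exact/lin_aug2/lmul_aug2. Qed.

(** A product has linear part 0, hence annihilates from the right; the rest of
    the right-symmetric identity is the commutativity of K[X_d]. *)
Lemma lpoly_Lvar : Lvar (lpoly K d).
Proof.
have mul0 (x y z : lpoly K d) : x ** (y ** z) = 0.
  by rewrite -![_ ** _]/(lmul _ _) /lmul -/(lmul y z) lin_lmul mulr0.
apply/LvarP; split=> // x y z; rewrite /assoc !mul0 !sub0r; congr (- _).
rewrite -![_ ** _]/(lmul _ _) [LHS]/lmul [RHS]/lmul !lmul_coef0 !subr0.
exact: mulrAC.
Qed.

Lemma gl_mpoly_lmul g p q :
  gl_mpoly g (lmul p q) = lmul (gl_mpoly g p) (gl_mpoly g q).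
Proof.
rewrite /lmul (rmorphM (gl_mpoly g)) (rmorphB (gl_mpoly g)) /=.
by rewrite gl_mpolyC gl_mpoly_coef0 lin_gl_mpoly.
Qed.

Definition scalar_poly r := exists c, r = c%:MP.

Lemma scalar_poly0 : scalar_poly 0. Proof. by exists 0; rewrite mpolyC0. Qed.
Lemma scalar_poly1 : scalar_poly 1. Proof. by exists 1. Qed.
Lemma scalar_polyD p q : scalar_poly p -> scalar_poly q -> scalar_poly (p + q).
Proof. by move=> [a ->] [b ->]; exists (a + b); rewrite mpolyCD. Qed.
Lemma scalar_polyM p q : scalar_poly p -> scalar_poly q -> scalar_poly (p * q).
Proof. by move=> [a ->] [b ->]; exists (a * b); rewrite mpolyCM. Qed.

Lemma nonlinD p q :
  nonlinear_part (p + q) = nonlinear_part p + nonlinear_part q.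
Proof. by rewrite /nonlinear_part linD mcoeffD mpolyCD; ring. Qed.

Lemma nonlinZ c p : nonlinear_part (c *: p) = c *: nonlinear_part p.
Proof.
by rewrite /nonlinear_part linZ mcoeffZ mpolyCM mul_mpolyC -!scalerBr.
Qed.

Lemma nonlin_lmul p q : nonlinear_part (lmul p q) =
  nonlinear_part p * linear_part q + linear_part p * linear_part q.
Proof. by rewrite nonlin_id -?mulrDl ?subrK //; exact: lmul_aug2. Qed.

(** Right multiplication by y only sees the linear part of y, a scalar
    combination of the linear parts of the generators, hence an element of R.
    By [nonlin_lmul] the nonlinear part of xy is the sum of an R-multiple of
    that of x and of the product of two such scalar combinations. *)
Lemma lpoly_gen (R : {mpoly K[d]} -> Prop) (s : seq (lpoly K d)) :
  (forall c, R c%:MP) -> (forall p q, R p -> R q -> R (p + q)) ->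
  (forall p q, R p -> R q -> R (p * q)) ->
  (forall p, p \in s -> R (linear_part p)) ->
  let ls := map (@linear_part K d) s in
  forall x : lpoly K d, alg_gen (fun y => y \in s) x ->
    lin_comb scalar_poly ls (linear_part x) /\
    lin_comb R (map (@nonlinear_part K d) s ++ [seq p * q | p <- ls, q <- ls])
      (nonlinear_part x).
Proof.
move=> RC RD RM Rs ls.
have R0 : R 0 by rewrite -mpolyC0; apply: RC.
have R1 : R 1 by apply: RC.
have RK r : scalar_poly r -> R r by move=> [c ->].
set gens := _ ++ _.
move=> x; elim=> {x} [x xs||x y _ [x1 x2] _ [y1 y2]|c x _ [x1 x2]
                    |x y _ [x1 x2] _ [y1 _]].
- split; apply: lin_comb_mem => //.
  + exact: scalar_poly0.
  + exact: scalar_poly1.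
  + exact: (map_f (@linear_part K d) xs).
  + by rewrite mem_cat (map_f (@nonlinear_part K d) xs).
- rewrite -(scale0r (0 : lpoly K d)) [_ *: _]/(_ *: (0 : {mpoly K[d]})).
  rewrite linZ nonlinZ !scale0r.
  by split; apply: lin_comb0 => //; exact: scalar_poly0.
- rewrite [x + y]/((x : {mpoly K[d]}) + y) linD nonlinD.
  by split; apply: lin_combD => //; exact: scalar_polyD.
- rewrite [c *: x]/(c *: (x : {mpoly K[d]})) linZ nonlinZ -!mul_mpolyC.
  by split; apply: lin_combM => //; [exact: scalar_polyM | exists c].
rewrite [x ** y]/(lmul x y) lin_lmul nonlin_lmul; split.
  exact/lin_comb0/scalar_poly0.
apply: lin_combD => //.
  rewrite mulrC; apply: lin_combM => //; have [r [rC ->]] := y1.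
  apply: (big_ind R) => // i _; apply: (RM); first exact: RK.
  have: ls`_i \in ls by exact: mem_nth.
  by case/mapP => p ps ->; exact: Rs.
have := lin_comb_mul scalar_poly0 scalar_poly1 scalar_polyD scalar_polyM x1 y1.
by apply: lin_comb_sub => // p ps; rewrite mem_cat ps orbT.
Qed.

End Lpoly.

(** * Homomorphisms from a relatively free algebra *)

Section RelfreeEval.
Variables (K : fieldType) (V : nonassocAlgType K -> Prop) (X : choiceType).
Variables (A : nonassocAlgType K) (a : X -> A).
(* This holds if A is in V, but also for every map a into relfree V X, without
   any assumption on V. *)
Hypothesis aV : forall f, f \in @tideal K V X -> na_eval a f = 0.
Implicit Types u v : relfree V X.

Definition relfree_eval u : A := na_eval a (repr u).

Lemma relfree_evalE f : relfree_eval (\pi_(relfree V X) f) = na_eval a f.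
Proof.
apply/eqP; rewrite -subr_eq0 -na_evalN -na_evalD; apply/eqP.
exact/aV/relfree_repr.
Qed.

Lemma relfree_eval_var x : relfree_eval (relfree_var V x) = a x.
Proof. by rewrite relfree_evalE na_eval_var. Qed.

Lemma relfree_evalD u v :
  relfree_eval (u + v) = relfree_eval u + relfree_eval v.
Proof.
elim/relfree_ind: u => f; elim/relfree_ind: v => g.
by rewrite -relfree_piD !relfree_evalE na_evalD.
Qed.

Lemma relfree_evalZ c u : relfree_eval (c *: u) = c *: relfree_eval u.
Proof.
elim/relfree_ind: u => f.
by rewrite -[c *: _]relfree_piZ !relfree_evalE na_evalZ.
Qed.

Lemma relfree_evalM u v :
  relfree_eval (u ** v) = relfree_eval u ** relfree_eval v.
Proof.
elim/relfree_ind: u => f; elim/relfree_ind: v => g.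
by rewrite -[_ ** _]relfree_piM !relfree_evalE na_evalM.
Qed.

Lemma relfree_eval0 : relfree_eval 0 = 0.
Proof. by rewrite -(scale0r 0) relfree_evalZ scale0r. Qed.

Lemma relfree_eval_sum I (r : seq I) (F : I -> relfree V X) :
  relfree_eval (\sum_(i <- r) F i) = \sum_(i <- r) relfree_eval (F i).
Proof. exact: (big_morph relfree_eval relfree_evalD relfree_eval0). Qed.

Lemma relfree_eval_gen (s : seq (relfree V X)) u :
  alg_gen (fun y => y \in s) u ->
  alg_gen (fun y => y \in map relfree_eval s) (relfree_eval u).
Proof.
elim=> {u} [u us||u v _ IHu _ IHv|c u _ IHu|u v _ IHu _ IHv].
- exact/alg_gen_in/map_f.
- by rewrite relfree_eval0; apply: alg_gen0.
- by rewrite relfree_evalD; apply: alg_genD.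
- by rewrite relfree_evalZ; apply: alg_genZ.
- by rewrite relfree_evalM; apply: alg_genM.
Qed.

End RelfreeEval.

(** * Polarization into the relatively free algebra *)

Section Polarization.
Variables (K : fieldType) (d : nat) (V : nonassocAlgType K -> Prop).
Local Notation P := {mpoly K[d]}.
Local Notation F := (relfree V (Choice.clone 'I_d _)).
Implicit Types (p q : P) (g : 'M[K]_d) (u v : F).

Let gl_vanishes g f : f \in @tideal K V _ ->
  na_eval (fun j => \sum_(i < d) g i j *: relfree_var V i) f = 0.
Proof. exact: relfree_eval_tideal. Qed.

(** The full polarization of the component of p of degree n + 1, written with
    left-normed products: the iterated derivatives of p are coefficients that
    fill the factors from the last to the first.  There is no unit in the
    relatively free algebra, so the recursion stops at the linear forms. *)
Fixpoint polar n p : F :=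
  if n is n'.+1 then
    n.+1%:R^-1 *: \sum_(i < d) polar n' p^`M(i) ** relfree_var V i
  else \sum_(i < d) p@_U_(i) *: relfree_var V i.

Lemma polarD n p q : polar n (p + q) = polar n p + polar n q.
Proof.
elim: n p q => [|n IHn] p q /=.
  by rewrite -big_split; apply: eq_bigr => i _; rewrite mcoeffD scalerDl.
rewrite -scalerDr -big_split; congr (_ *: _); apply: eq_bigr => i _ /=.
by rewrite mderivD IHn namulDl.
Qed.

Lemma polarZ n c p : polar n (c *: p) = c *: polar n p.
Proof.
elim: n p => [|n IHn] p /=.
  by rewrite scaler_sumr; apply: eq_bigr => i _; rewrite mcoeffZ scalerA.
rewrite scalerA mulrC -scalerA; congr (_ *: _); rewrite scaler_sumr.
by apply: eq_bigr => i _; rewrite mderivZ IHn namulZl.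
Qed.

Lemma polar_sum n I (r : seq I) (E : I -> P) :
  polar n (\sum_(i <- r) E i) = \sum_(i <- r) polar n (E i).
Proof.
apply: (big_morph (polar n) (polarD n)).
by rewrite -(scale0r 0) polarZ scale0r.
Qed.

(** The matrix entries produced by the chain rule for p move, by bilinearity, to
    the variable that follows the polarized derivative. *)
Lemma gl_polar g n p : gl_relfree g (polar n p) = polar n (gl_mpoly g p).
Proof.
have glE := @relfree_eval_var _ _ _ _ _ (gl_vanishes g).
elim: n p => [|n IHn] p /=.
  rewrite [LHS](relfree_eval_sum (gl_vanishes g)).
  under [LHS]eq_bigr do rewrite (relfree_evalZ (gl_vanishes g)) glE scaler_sumr.
  rewrite exchange_big; apply: eq_bigr => i _ /=.
  rewrite gl_mpoly_coef1 scaler_suml; apply: eq_bigr => j _.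
  by rewrite scalerA mulrC.
rewrite [LHS](relfree_evalZ (gl_vanishes g)) (relfree_eval_sum (gl_vanishes g)).
apply: (congr1 ( *:%R n.+2%:R^-1)).
under [LHS]eq_bigr do
  rewrite (relfree_evalM (gl_vanishes g)) [relfree_eval _ _]IHn glE namul_sumr.
rewrite exchange_big; apply: eq_bigr => i _ /=.
rewrite mderiv_gl_mpoly polar_sum namul_suml; apply: eq_bigr => j _.
by rewrite polarZ namulZl namulZr.
Qed.

Hypothesis LV : forall A : nonassocAlgType K, Lvar A -> V A.

(** A left-normed word in the variables goes to the commutative monomial with
    the same letters, and every other bracketed word goes to 0. *)
Definition topoly : F -> lpoly K d := relfree_eval (fun i => 'X_i : lpoly K d).

Let topoly_vanishes f : f \in @tideal K V _ ->
  na_eval (fun i => 'X_i : lpoly K d) f = 0.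
Proof. by move/tidealP; apply; apply/LV/lpoly_Lvar. Qed.

(** Both sides are homomorphisms of u, since g preserves the product [lmul], and
    they agree on the variables. *)
Lemma topoly_gl g u : topoly (gl_relfree g u) = gl_mpoly g (topoly u).
Proof.
have toE := @relfree_eval_var _ _ _ _ _ topoly_vanishes.
elim/relfree_ind: u => f.
rewrite /gl_relfree relfree_substE /topoly (relfree_evalE topoly_vanishes).
rewrite (@na_eval_comp _ _ _ _ _ (relfree_eval (fun i => 'X_i : lpoly K d))).
- rewrite (@na_eval_comp _ _ (lpoly K d) (lpoly K d) _ (gl_mpoly g)).
  + congr (na_eval _ f); apply: funext => j /=.
    rewrite (relfree_eval_sum topoly_vanishes) gl_mpolyX; apply: eq_bigr => i _.
    by rewrite (relfree_evalZ topoly_vanishes) toE.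
  + exact: raddfD.
  + by move=> c p; exact: linearZ.
  + exact: gl_mpoly_lmul.
- exact: (relfree_evalD topoly_vanishes).
- exact: (relfree_evalZ topoly_vanishes).
- exact: (relfree_evalM topoly_vanishes).
Qed.

Hypothesis K0 : [pchar K] =i pred0.

Lemma euler_formula (m : 'X_{1..d}) :
  \sum_(i < d) ('X_[m] : P)^`M(i) * 'X_i = (mdeg m)%:R *: 'X_[m].
Proof.
rewrite mdegE natr_sum scaler_suml; apply: eq_bigr => i _.
rewrite mderivX -scalerAl -mpolyXD; have [->|mi] := eqVneq (m i) 0%N.
  by rewrite !scale0r.
by rewrite submK // lep1mP.
Qed.

(** Euler's formula yields the factor n + 2 in the inductive step, which cancels
    the one of the polarization. *)
Lemma topoly_polar_mon n (m : 'X_{1..d}) :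
  topoly (polar n 'X_[m]) = if mdeg m == n.+1 then 'X_[m] else 0 : P.
Proof.
have toE := @relfree_eval_var _ _ _ _ _ topoly_vanishes.
elim: n m => [|n IHn] m /=.
  rewrite /topoly (relfree_eval_sum topoly_vanishes).
  under [LHS]eq_bigr do rewrite (relfree_evalZ topoly_vanishes) toE.
  rewrite -[LHS]/(linear_part 'X_[m]); case: (mdeg1P m) => [[i /eqP ->]|m1].
    exact: lin_X.
  rewrite /linear_part big1 // => i _; rewrite mcoeffX.
  case: eqP => [E|]; last by rewrite scale0r.
  by case: m1; exists i; apply/eqP.
rewrite /topoly (relfree_evalZ topoly_vanishes).
rewrite (relfree_eval_sum topoly_vanishes).
under [X in _ *: X]eq_bigr => i _.
  rewrite (relfree_evalM topoly_vanishes) toE mderivX polarZ.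
  rewrite (relfree_evalZ topoly_vanishes) -/topoly IHn.
  set p := (if _ then _ else _ : P).
  (* If 'X_i does not occur in m, the subtraction m - U_(i) truncates and its
     degree is not that of m minus 1, but then the coefficient m i vanishes. *)
  have -> : ((m i)%:R *: (p : lpoly K d)) ** ('X_i : lpoly K d) =
    if mdeg m == n.+2 then ('X_[m] : P)^`M(i) * 'X_i else 0.
    rewrite {}/p [LHS]/(lmul _ _) /lmul lin_X mderivX.
    have [->|mi] := eqVneq (m i) 0%N.
      by rewrite ![_ *: _]scale0r mcoeff0 mpolyC0 subr0 !mul0r if_same.
    have Em : mdeg m = (mdeg (m - U_(i))%MM).+1.
      have le_im : (U_(i) <= m)%MM by rewrite lep1mP.
      by rewrite -[in LHS](submK le_im) mdegD mdeg1 addn1.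
    rewrite Em eqSS; case: eqP => [E|_]; last first.
      by rewrite [_ *: _]scaler0 mcoeff0 mpolyC0 subr0 mul0r.
    by rewrite mcoeffZ mcoeffX -mdeg_eq0 E mulr0 mpolyC0 subr0.
  over.
case: eqP => [Em|_]; last by rewrite big1 // scaler0.
rewrite [X in _ *: X]euler_formula Em scalerA mulVf ?scale1r //.
by move/pcharf0P: K0 => ->.
Qed.

Lemma topoly_polar n p : topoly (polar n p) =
  \sum_(m <- msupp p) p@_m *: (if mdeg m == n.+1 then 'X_[m] else 0 : P).
Proof.
rewrite {1}(mpolyE p) polar_sum [LHS](relfree_eval_sum topoly_vanishes).
apply: eq_bigr => m _.
rewrite polarZ [LHS](relfree_evalZ topoly_vanishes).
by rewrite [relfree_eval _ _]topoly_polar_mon.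
Qed.

(** The summand of index n yields the component of degree n + 1, so the sum
    misses only the constant term; its last summand, beyond the degree of p,
    gives 0. *)
Lemma topoly_sum_polar p : p@_0%MM = 0 ->
  topoly (\sum_(n < msize p) polar n p) = p.
Proof.
move=> p0; rewrite [LHS](relfree_eval_sum topoly_vanishes).
under [LHS]eq_bigr do rewrite [relfree_eval _ _]topoly_polar.
rewrite exchange_big [RHS]mpolyE big_seq [RHS]big_seq.
apply: eq_bigr => m mp /=.
rewrite -scaler_sumr; congr (_ *: _).
have lt_m : ((mdeg m).-1 < msize p)%N.
  exact: leq_ltn_trans (leq_pred _) (msize_mdeg_lt mp).
have m0 : (0 < mdeg m)%N.
  rewrite lt0n mdeg_eq0; apply: contraTneq mp => ->.
  by rewrite mcoeff_msupp p0 eqxx.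
rewrite (bigD1 (Ordinal lt_m)) //= prednK // eqxx big1 ?addr0 // => n.
by rewrite -val_eqE /= -eqSS prednK // eq_sym => /negPf->.
Qed.

(** * From generators of the invariants to generators of the module *)

Variable G : 'M[K]_d -> Prop.

Lemma topoly_fix u : relfree_fix G u -> mpoly_fix G (topoly u).
Proof. by move=> uG g Gg; rewrite -topoly_gl uG. Qed.

Lemma polar_fix n p : mpoly_fix G p -> relfree_fix G (polar n p).
Proof. by move=> pG g Gg; rewrite gl_polar pG. Qed.

(** Polarizing all components of p at once avoids having to know that the
    components of an invariant are invariant. *)
Lemma topoly_onto p : p@_0%MM = 0 -> mpoly_fix G p ->
  exists2 u : F, relfree_fix G u & topoly u = p.
Proof.
move=> p0 pG.
exists (\sum_(n < msize p) polar n p); last exact: topoly_sum_polar.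
move=> g Gg; rewrite [LHS](relfree_eval_sum (gl_vanishes g)).
by apply: eq_bigr => n _; apply: polar_fix.
Qed.

Lemma fin_gen_aug2_fix : fin_gen_subalg (@relfree_fix K d V G) ->
  fin_gen_submod (unital_subalg (linear_fix G)) (mpoly_aug2_fix G).
Proof.
case=> s sP; set R := unital_subalg _.
have s_fix p : p \in map topoly s -> mpoly_fix G p.
  by case/mapP=> u us ->; apply/topoly_fix/sP/alg_gen_in.
have lin_fixP p : mpoly_fix G p -> linear_fix G (linear_part p).
  by move=> pG; split=> [|g Gg]; rewrite ?lin_homog // -lin_gl_mpoly pG.
pose ls := map (@linear_part K d) (map topoly s).
exists (map (@nonlinear_part K d) (map topoly s) ++
  [seq p * q | p <- ls, q <- ls]).
split=> [b|b [b2 bG]].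
  rewrite mem_cat => /orP[/mapP[p ps ->]|].
    split; first exact: nonlin_aug2.
    by move=> g Gg; rewrite -nonlin_gl_mpoly (s_fix p).
  case/allpairsP => -[_ _] /= [/mapP[p ps ->] /mapP[q qs ->] ->]; split.
    exists [:: (linear_part p, linear_part q)]; split; last by rewrite big_seq1.
    by move=> u; rewrite inE => /eqP->; split; exact: lin_coef0.
  by move=> g Gg; rewrite (rmorphM (gl_mpoly g)) /= -!lin_gl_mpoly !s_fix.
have b0 : b@_0%MM = 0 by move/mpoly_aug2P: b2; apply; rewrite mdeg0.
have [u uG ub] := topoly_onto b0 bG.
have := relfree_eval_gen topoly_vanishes (proj1 (sP u) uG).
rewrite -[relfree_eval _ _]/(topoly u) ub => /lpoly_gen-/(_ R)[].
- exact: unital_subalg_const.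
- exact: unital_subalgD.
- exact: unital_subalgM.
- by move=> p /s_fix/lin_fixP; apply: unital_subalg_in.
by move=> _; rewrite nonlin_id.
Qed.

End Polarization.

Theorem corollary2p3 (K : fieldType) (K0 : [pchar K] =i pred0)
    (d : nat) (d_ge2 : (2 <= d)%N)
    (G : 'M[K]_d -> Prop) (subG : GL_subgroup G)
    (not_fg : ~ fin_gen_submod (unital_subalg (linear_fix G))
                               (mpoly_aug2_fix G))
    (V : nonassocAlgType K -> Prop) (varV : is_variety V)
    (LV : forall A : nonassocAlgType K, Lvar A -> V A) :
  ~ fin_gen_subalg (@relfree_fix K d V G).
Proof. by move/(fin_gen_aug2_fix LV K0). Qed.
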